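(* In the axiom system $\mathtt{TMM}$, the scheme $\mathtt{spec}$ cannot be weakened by adding any disjoint variable condition: the scheme $\mathtt{spec}$ (i.e. $\forall x\,\phi\to\phi$ without disjoint variable conditions) is not provable from the set of schemes consisting of $\mathtt{TMM}\setminus\{\mathtt{spec}\}$ together with the scheme $(\forall x\,\phi\to\phi,\ \{\{x,\phi\}\})$. In particular, $\mathtt{spec}$ is independent in $\mathtt{TMM}$.
   Context: **Metavariables and metaformulas.** Let $\mathrm{vrMV}=\{x_i\mid i\in\omega\}$ (variable metavariables) and $\mathrm{fmMV}=\{\phi_i\mid i\in\omega\}$ (formula metavariables) be disjoint countably infinite sets of symbols, and $\mathrm{MV}=\mathrm{vrMV}\cup\mathrm{fmMV}$. A language $\mathcal L$ is a set of further symbols (nonlogical predicates) with an arity function $\mathcal L\to\omega$. Fix a language $\mathcal L$. A metaformula is one of: a formula metavariable; $x_i\equiv x_j$; $P(x_{i_1},\dots,x_{i_r})$ with $P\in\mathcal L$ of arity $r$; $\forall x_i\,\Phi$; $\neg\Phi$; $\Phi\to\Psi$, where $\Phi,\Psi$ are metaformulas. $\mathrm{MF}$ is the set of metaformulas. $\mathrm{OC}(\Phi)\subseteq\mathrm{MV}$ is the set of metavariables occurring in $\Phi$ (including those directly after a quantifier), and $\mathrm{OC}(x_i)=\{x_i\}$. For a set $X$, $\mathcal P_2(X)$ is the set of its two-element subsets. **Schemes.** A scheme $\Phi=(\{\Phi_1,\dots,\Phi_n\},\Phi_0,\mathrm{DV}(\Phi))$ consists of a finite set of metaformulas (hypotheses),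 a metaformula (conclusion), and a set $\mathrm{DV}(\Phi)\subseteq\mathcal P_2(\mathrm{OC}(\Phi))$ (disjoint variable conditions), where $\mathrm{OC}(\Phi)$ is the set of metavariables occurring in its hypotheses or conclusion. Writing $(\Phi_I,\Phi_0,D)$ with a larger $D$ means that $D$ is intersected with $\mathcal P_2(\mathrm{OC}(\Phi))$. Such a scheme is displayed as $\Phi_1\;\&\;\dots\;\&\;\Phi_n\Longrightarrow\Phi_0,\ \mathrm{DV}(\cdot,\cdot),\dots$, where $\mathrm{DV}(m,n)$ denotes the condition $\{m,n\}$; a scheme without hypotheses is written $(\Phi_0,\mathrm{DV}(\Phi))$. **Substitution and instances.** A substitution is a map $\sigma:\mathrm{MV}\to\mathrm{vrMV}\cup\mathrm{MF}$ with $\sigma(\mathrm{vrMV})\subseteq\mathrm{vrMV}$, $\sigma(\mathrm{fmMV})\subseteq\mathrm{MF}$ and $\sigma(m)=m$ for all but finitely many $m$. $\Phi^\sigma$ is the result of simultaneous plain substitution in the metaformula $\Phi$ (variable metavariables after quantifiers are also replaced). For $D\subseteq\mathcal P_2(\mathrm{MV})$, $D^\sigma=\{\{m,n\}\in\mathcal P_2(\mathrm{MV})\mid\exists\{m',n'\}\in D,\ m\in\mathrm{OC}(\sigma(m')),\ n\in\mathrm{OC}(\sigma(n'))\}$. $\sigma$ is legitimate on a scheme $\Phi$ if $\{m,n\}\in\mathrm{DV}(\Phi)$ implies $\mathrm{OC}(\sigma(m))\cap\mathrm{OC}(\sigma(n))=\varnothing$. A scheme $\Psi$ is an instance of $\Phi$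 if for some $\sigma$ legitimate on $\Phi$ the hypotheses and conclusion of $\Psi$ are the images under $\sigma$ of those of $\Phi$ and $\mathrm{DV}(\Phi)^\sigma\subseteq\mathrm{DV}(\Psi)$. **Proofs.** A proof of a scheme $\Phi$ from a set of schemes $S$ is a finite sequence $P$ of metaformulas (lines) whose last line is the conclusion of $\Phi$ and such that each line $P_i$ that is not a hypothesis of $\Phi$ admits $i_1,\dots,i_n<i$ for which $(\{P_{i_1},\dots,P_{i_n}\},P_i,\mathrm{DV}(P))$ is an instance of a scheme in $S$, where $\mathrm{DV}(P)=\mathrm{DV}(\Phi)\cup\{\{m,n\}\mid m\in\mathrm{OC}(P)\setminus\mathrm{OC}(\Phi),\ n\in\mathrm{OC}(P),\ m\ne n\}$ and $\mathrm{OC}(P)$ is the set of metavariables occurring in the lines of $P$ (or in $\Phi$). $\Phi$ is provable from $S$ if such a proof exists. A scheme is independent in a set of schemes containing it if it is not provable from the other schemes of that set. (Provability does not depend on the choice of the language containing the symbols involved.) **The system $\mathtt{TMM}$.** With $x,y,z$ distinct variable metavariables and $\phi,\psi,\chi,\theta,\tau$ distinct formula metavariables, $\mathtt{TMM}$ is the set of the following schemes: - $\mathtt{mp}$: $\phi\;\&\;\phi\to\psi\Longrightarrow\psi$ - $\mathtt{minimp}$: $\phi\to((\psi\to\chi)\to(((\theta\to\psi)\to(\chi\to\tau))\to(\psi\to\tau)))$ - $\mathtt{peirce}$: $((\phi\to\psi)\to\phi)\to\phi$ - $\mathtt{contrap}$: $(\phi\to\neg\psi)\to(\psi\to\neg\phi)$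 - $\mathtt{notelim}$: $\neg\phi\to(\phi\to\psi)$ - $\mathtt{gen}$: $\phi\Longrightarrow\forall x\,\phi$ - $\mathtt{ALLdistr}$: $\forall x(\phi\to\psi)\to(\forall x\,\phi\to\forall x\,\psi)$ - $\mathtt{spec}$: $\forall x\,\phi\to\phi$ - $\mathtt{modal5}$: $\neg\forall x\,\phi\to\forall x\,\neg\forall x\,\phi$ - $\mathtt{vacGen}$: $\phi\to\forall x\,\phi,\ \mathrm{DV}(x,\phi)$ - $\mathtt{ALLcomm}$: $\forall x\forall y\,\phi\to\forall y\forall x\,\phi$ - $\mathtt{EQrefl}$: $x\equiv x$ - $\mathtt{EQsymm}$: $x\equiv y\to y\equiv x$ - $\mathtt{EQtrans}$: $x\equiv y\to(y\equiv z\to x\equiv z)$ - $\mathtt{denot}$: $x\equiv x\to\neg\forall y\,\neg\,y\equiv x,\ \mathrm{DV}(x,y)$ - $\mathtt{subst}$: $\forall x(x\equiv y\to(\phi\to\forall x(x\equiv y\to\phi))),\ \mathrm{DV}(x,y),\ \mathrm{DV}(y,\phi)$ - $\mathtt{ALLeq}$: $\forall x\,x\equiv y\to(\forall x\,\phi\to\forall y\,\phi)$ - $\mathtt{genEq}$: $\neg\forall x\,x\equiv y\to(\neg\forall x\,x\equiv z\to(y\equiv z\to\forall x\,y\equiv z))$ *)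

(* Defs.v *)
From HB Require Import structures.
From mathcomp Require Import all_boot finmap.
From mathcomp Require Import boolp classical_sets functions cardinality.

Set Implicit Arguments.
Unset Strict Implicit.
Unset Printing Implicit Defensive.

Local Open Scope classical_set_scope.

(* Variable and formula metavariables are represented by their indices; the
   two constructors of [metavar] keep them disjoint. *)
Definition vrMV := nat.
Definition fmMV := nat.

Variant metavar := Vr of vrMV | Fm of fmMV.

Record language := Language { symbol : Type; arity : symbol -> nat }.

Inductive metaformula (L : language) :=
  | FVar of fmMV
  | Equ of vrMV & vrMV
  | Pred (P : symbol L) of (arity P).-tuple vrMV
  | All of vrMV & metaformula L
  | Neg of metaformula L
  | Imp of metaformula L & metaformula L.

Arguments FVar {L}.
Arguments Equ {L}.
Arguments All {L}.

(* Classical equality and choice, only needed to form {fset metaformula L}. *)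
HB.instance Definition _ (L : language) := gen_eqMixin (metaformula L).
HB.instance Definition _ (L : language) := gen_choiceMixin (metaformula L).

Declare Scope metaformula_scope.
Delimit Scope metaformula_scope with MF.
Bind Scope metaformula_scope with metaformula.
Notation "A ==> B" := (Imp A B) : metaformula_scope.

Fixpoint OC (L : language) (A : metaformula L) : set metavar :=
  match A with
  | FVar i => [set Fm i]
  | Equ x y => [set Vr x; Vr y]
  | Pred _ t => [set Vr x | x in [set x | x \in tval t]]
  | All x B => Vr x |` OC B
  | Neg B => OC B
  | Imp B C => OC B `|` OC C
  end.

Definition pairs (X : set metavar) : set (set metavar) :=
  [set p | exists m n, [/\ X m, X n, m <> n & p = [set m; n]]].

Definition OC_rule (L : language) (hs : {fset metaformula L})
    (c : metaformula L) : set metavar :=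
  [set m | (exists2 A, A \in hs & OC A m) \/ OC c m].

Record scheme (L : language) := Scheme {
  hyps : {fset metaformula L};
  concl : metaformula L;
  DV : set (set metavar);
  DV_sub : DV `<=` pairs (OC_rule hyps concl) }.

Definition OC_scheme (L : language) (Phi : scheme L) : set metavar :=
  OC_rule (hyps Phi) (concl Phi).

Definition mk_scheme (L : language) (hs : {fset metaformula L})
    (c : metaformula L) (D : set (set metavar)) : scheme L :=
  @Scheme L hs c (D `&` pairs (OC_rule hs c)) (@subIsetr _ _ _).

(* The conditions s(vrMV) <= vrMV and s(fmMV) <= MF are built into the types of
   the two components. *)
Record substitution (L : language) := Substitution {
  on_vr : vrMV -> vrMV;
  on_fm : fmMV -> metaformula L;
  on_vr_fin : finite_set [set i | on_vr i <> i];
  on_fm_fin : finite_set [set i | on_fm i <> FVar i] }.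

Fixpoint subst_mf (L : language) (s : substitution L) (A : metaformula L) :
    metaformula L :=
  match A with
  | FVar i => on_fm s i
  | Equ x y => Equ (on_vr s x) (on_vr s y)
  | Pred P t => Pred [tuple of map (on_vr s) t]
  | All x B => All (on_vr s x) (subst_mf s B)
  | Neg B => Neg (subst_mf s B)
  | Imp B C => Imp (subst_mf s B) (subst_mf s C)
  end.

Definition OC_image (L : language) (s : substitution L) (m : metavar) :
    set metavar :=
  match m with
  | Vr x => [set Vr (on_vr s x)]
  | Fm i => OC (on_fm s i)
  end.

Definition subst_DV (L : language) (s : substitution L)
    (D : set (set metavar)) : set (set metavar) :=
  [set p | exists m n, [/\ m <> n, p = [set m; n] &
     exists m' n', [/\ D [set m'; n'], OC_image s m' m & OC_image s n' n]]].

Definition legitimate (L : language) (s : substitution L) (Phi : scheme L) :=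
  forall m n, DV Phi [set m; n] -> OC_image s m `&` OC_image s n = set0.

Definition instance_of (L : language) (Psi Phi : scheme L) :=
  exists s : substitution L,
    [/\ legitimate s Phi,
        hyps Psi = [fset subst_mf s A | A in hyps Phi]%fset,
        concl Psi = subst_mf s (concl Phi) &
        subst_DV s (DV Phi) `<=` DV Psi].

Definition OC_proof (L : language) (Phi : scheme L) (P : seq (metaformula L)) :
    set metavar :=
  [set m | (exists2 A, A \in P & OC A m) \/ OC_scheme Phi m].

Definition DV_proof (L : language) (Phi : scheme L) (P : seq (metaformula L)) :
    set (set metavar) :=
  DV Phi `|`
  [set p | exists m n, [/\ OC_proof Phi P m, ~ OC_scheme Phi m,
                           OC_proof Phi P n, m <> n & p = [set m; n]]].

Definition is_proof (L : language) (S : set (scheme L)) (Phi : scheme L)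
    (P : seq (metaformula L)) :=
  let line := nth (concl Phi) P in
  [/\ P <> [::], last (concl Phi) P = concl Phi &
      forall i, i < size P ->
        line i \in hyps Phi \/
        exists js : seq nat, exists Psi : scheme L,
          [/\ all (fun j => j < i) js, S Psi &
              instance_of
                (mk_scheme [fset line j | j in js]%fset (line i)
                           (DV_proof Phi P))
                Psi]].

Definition provable (L : language) (S : set (scheme L)) (Phi : scheme L) :=
  exists P, is_proof S Phi P.

Definition independent (L : language) (S : set (scheme L)) (Phi : scheme L) :=
  S Phi /\ ~ provable (S `\ Phi) Phi.

Local Notation x := 0.
Local Notation y := 1.
Local Notation z := 2.
Local Notation phi_ := 0.
Local Notation phi := (FVar phi_).
Local Notation psi := (FVar 1).
Local Notation chi := (FVar 2).
Local Notation theta := (FVar 3).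
Local Notation tau := (FVar 4).

Definition ax_mp (L : language) : scheme L :=
  mk_scheme [fset phi; (phi ==> psi)%MF]%fset psi set0.

Definition ax_minimp (L : language) : scheme L :=
  mk_scheme fset0 (phi ==> ((psi ==> chi) ==>
    (((theta ==> psi) ==> (chi ==> tau)) ==> (psi ==> tau)))) set0.

Definition ax_peirce (L : language) : scheme L :=
  mk_scheme fset0 (((phi ==> psi) ==> phi) ==> phi) set0.

Definition ax_contrap (L : language) : scheme L :=
  mk_scheme fset0 ((phi ==> Neg psi) ==> (psi ==> Neg phi)) set0.

Definition ax_notelim (L : language) : scheme L :=
  mk_scheme fset0 (Neg phi ==> (phi ==> psi)) set0.

Definition ax_gen (L : language) : scheme L :=
  mk_scheme [fset phi]%fset (All x phi) set0.

Definition ax_ALLdistr (L : language) : scheme L :=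
  mk_scheme fset0 (All x (phi ==> psi) ==> (All x phi ==> All x psi)) set0.

Definition ax_spec (L : language) : scheme L :=
  mk_scheme fset0 (All x phi ==> phi) set0.

Definition ax_spec_DV (L : language) : scheme L :=
  mk_scheme fset0 (All x phi ==> phi) [set [set Vr x; Fm phi_]].

Definition ax_modal5 (L : language) : scheme L :=
  mk_scheme fset0 (Neg (All x phi) ==> All x (Neg (All x phi))) set0.

Definition ax_vacGen (L : language) : scheme L :=
  mk_scheme fset0 (phi ==> All x phi) [set [set Vr x; Fm phi_]].

Definition ax_ALLcomm (L : language) : scheme L :=
  mk_scheme fset0 (All x (All y phi) ==> All y (All x phi)) set0.

Definition ax_EQrefl (L : language) : scheme L :=
  mk_scheme fset0 (Equ x x) set0.

Definition ax_EQsymm (L : language) : scheme L :=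
  mk_scheme fset0 (Equ x y ==> Equ y x) set0.

Definition ax_EQtrans (L : language) : scheme L :=
  mk_scheme fset0 (Equ x y ==> (Equ y z ==> Equ x z)) set0.

Definition ax_denot (L : language) : scheme L :=
  mk_scheme fset0 (Equ x x ==> Neg (All y (Neg (Equ y x))))
    [set [set Vr x; Vr y]].

Definition ax_subst (L : language) : scheme L :=
  mk_scheme fset0 (All x (Equ x y ==> (phi ==> All x (Equ x y ==> phi))))
    [set [set Vr x; Vr y]; [set Vr y; Fm phi_]].

Definition ax_ALLeq (L : language) : scheme L :=
  mk_scheme fset0 (All x (Equ x y) ==> (All x phi ==> All y phi)) set0.

Definition ax_genEq (L : language) : scheme L :=
  mk_scheme fset0 (Neg (All x (Equ x y)) ==>
    (Neg (All x (Equ x z)) ==> (Equ y z ==> All x (Equ y z)))) set0.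

Definition TMM (L : language) : set (scheme L) :=
  [set ax_mp L;
       ax_minimp L;
       ax_peirce L;
       ax_contrap L;
       ax_notelim L;
       ax_gen L;
       ax_ALLdistr L;
       ax_spec L;
       ax_modal5 L;
       ax_vacGen L;
       ax_ALLcomm L;
       ax_EQrefl L;
       ax_EQsymm L;
       ax_EQtrans L;
       ax_denot L;
       ax_subst L;
       ax_ALLeq L;
       ax_genEq L].

Arguments TMM L : clear implicits.

(* Main.v *)
(* Interpret metaformulas over states made of an assignment of booleans to the
   variables and one extra bit; the formula metavariable [phi] of [spec] reads
   that bit.  Quantifying over a variable varies its value, and quantifying over
   the variable [x] of [spec] also resets the bit to true.  Then
   [forall x phi] is valid while [phi] is not, although a formula in which [x]
   does not occur, and which does not involve [phi], is unaffected by [forall x].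
   Two truth values are needed so that [forall x, x = y] fails for x <> y. *)
Require Import Defs.
From mathcomp Require Import all_boot finmap.
From mathcomp Require Import boolp classical_sets.
Local Open Scope classical_set_scope.

Definition state := ((nat -> bool) * bool)%type.

(** The bit is only ever raised, so updates at one variable absorb each other and updates at
    distinct variables commute, as [modal5] and [ALLcomm] require. *)
Definition step (x : nat) (m : bool) (s : state) : state :=
  (fun i => if i == x then m else s.1 i, (x == 0) || s.2).

Lemma step_same x m n s : step x m (step x n s) = step x m s.
Proof.
rewrite /step /= orbA orbb; congr pair.
by apply/funext => i; case: eqP.
Qed.

Lemma stepC x y m n s : x <> y ->
  step x m (step y n s) = step y n (step x m s).
Proof.
move=> xy; rewrite /step /= orbCA; congr pair.
by apply/funext => i; case: eqP => // ->; case: eqP.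
Qed.

Lemma step_at x m s : (step x m s).1 x = m.
Proof. by rewrite /step /= eqxx. Qed.

Lemma step_off x y m s : y <> x -> (step x m s).1 y = s.1 y.
Proof. by rewrite /step => /eqP/negbTE /= ->. Qed.

Lemma step_bit x m s : (step x m s).2 = (x == 0) || s.2.
Proof. by []. Qed.

Opaque step.

Section Semantics.
Variable L : language.
Implicit Types (A : metaformula L) (s : substitution L) (Psi : scheme L).

Fixpoint holds A (w : state) : bool :=
  match A with
  | FVar i => (i != 0) || w.2
  | Equ x y => w.1 x == w.1 y
  | Pred _ _ => true
  | All x B => holds B (step x true w) && holds B (step x false w)
  | Neg B => ~~ holds B w
  | Imp B C => holds B w ==> holds C w
  end.

Definition valid A := forall w, holds A w.

Definition invariant x A := forall m w, holds A (step x m w) = holds A w.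

(** Only [Fm 0] reads the bit and only an update at variable 0 changes it. Bound variables differ
    from [x], so the update commutes past the quantifiers. *)
Lemma invariantP x A :
  ~ OC A (Vr x) -> (OC A (Fm 0) -> x <> 0) -> invariant x A.
Proof.
elim: A => [i|y z|P t|y A IH|A IH|A IHA B IHB] xA x0 m w /=.
- by case: i x0 {xA} => // /(_ erefl) /eqP/negbTE; rewrite /= step_bit => ->.
- by rewrite !step_off // => e; apply: xA; rewrite e; [right | left].
- by [].
- have xy : x <> y by move=> e; apply: xA; left; rewrite e.
  have {}IH : invariant x A.
    by apply: IH => h; [apply: xA; right | apply: x0; right].
  by rewrite -!(stepC x y _ _ _ xy) !IH.
- by rewrite IH.
- by rewrite IHA ?IHB // => h; first [apply: xA | apply: x0];
    by [left | right].
Qed.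

(** Semantic form of the disjoint variable conditions: invariance replaces non-occurrence. *)
Definition admissible s Psi :=
  (forall x y, DV Psi [set Vr x; Vr y] -> on_vr s x <> on_vr s y) /\
  (forall x i, DV Psi [set Vr x; Fm i] -> invariant (on_vr s x) (on_fm s i)).

Definition sound Psi := forall s, admissible s Psi ->
  (forall A, A \in hyps Psi -> valid (subst_mf s A)) ->
  valid (subst_mf s (concl Psi)).

(** Every condition available in a proof of [spec] involves a metavariable foreign to [spec]. Hence
    [Vr 0] and [Fm 0] are never declared disjoint, which rules out the case excluded in
    [invariantP]. *)
Lemma admissible_step s Psi P (js : {fset metaformula L}) c :
  legitimate s Psi ->
  subst_DV s (DV Psi) `<=` DV (mk_scheme js c (DV_proof (ax_spec L) P)) ->
  admissible s Psi.
Proof.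
move=> leg sub; split=> [x y /leg /= e xy | x i D].
  (* [False] is recast as membership in [set0], which [e] turns into membership in both images. *)
  by rewrite -[False]/((set0 : set metavar) (Vr (on_vr s x))) -e /= xy.
have /= e := leg _ _ D.
apply: invariantP => [xA | A0 x0].
  by rewrite -[False]/((set0 : set metavar) (Vr (on_vr s x))) -e /=.
have /sub [] : subst_DV s (DV Psi) [set Vr 0; Fm 0].
  exists (Vr 0), (Fm 0); split=> //.
  by exists (Vr x), (Fm i); split=> //=; rewrite x0.
(* [DV] of [spec] is empty, so the pair must contain some [m] foreign to [spec]. *)
case=> [[[]]|] // [m [n [_ nm _ _ mn]]] _; apply: nm.
have : [set Vr 0; Fm 0] m by rewrite mn; left.
by case=> ->; right; [left; left | right].
Qed.

Lemma soundness S P :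
  (forall Psi, S Psi -> sound Psi) -> is_proof S (ax_spec L) P ->
  valid (concl (ax_spec L)).
Proof.
move=> Ssound [P0 Plast Pline].
suff lineP i : i < size P -> valid (nth (concl (ax_spec L)) P i).
  rewrite -Plast -nth_last; apply: lineP.
  by case: (P) P0.
elim/ltn_ind: i => i IH iP.
have [|[js [Psi [/allP js_lt SPsi [s [leg /= hs -> sub]]]]]] := Pline i iP.
  by rewrite in_fset0.
apply: Ssound (admissible_step _ _ _ _ _ leg sub) _ => // A AP.
have : subst_mf s A \in [fset subst_mf s A | A in hyps Psi]%fset.
  by apply/imfsetP; exists A.
rewrite -hs => /imfsetP[j /= /js_lt ji ->].
by apply: IH => //; apply: ltn_trans iP.
Qed.

Lemma DV_mk_scheme (hs : {fset metaformula L}) c D m n :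
  D [set m; n] -> m <> n -> OC_rule hs c m -> OC_rule hs c n ->
  DV (mk_scheme hs c D) [set m; n].
Proof. by move=> Dmn mn cm cn; split=> //; exists m, n. Qed.

Lemma sound_mp : sound (ax_mp L).
Proof.
move=> s _ h w.
have /(_ w) /= p : valid (subst_mf s (FVar 0)).
  by apply: h; apply: fset21.
have /(_ w) /= : valid (subst_mf s (Imp (FVar 0) (FVar 1))).
  by apply: h; apply: fset22.
by rewrite p.
Qed.

Lemma sound_gen : sound (ax_gen L).
Proof.
move=> s _ h w.
have p : valid (subst_mf s (FVar 0)) by apply: h; apply: fset11.
by rewrite /= !p.
Qed.

Lemma sound_minimp : sound (ax_minimp L).
Proof. by move=> s _ _ w /=; do 5!case: (holds _ _). Qed.

Lemma sound_peirce : sound (ax_peirce L).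
Proof. by move=> s _ _ w /=; do 2!case: (holds _ _). Qed.

Lemma sound_contrap : sound (ax_contrap L).
Proof. by move=> s _ _ w /=; do 2!case: (holds _ _). Qed.

Lemma sound_notelim : sound (ax_notelim L).
Proof. by move=> s _ _ w /=; do 2!case: (holds _ _). Qed.

Lemma sound_ALLdistr : sound (ax_ALLdistr L).
Proof. by move=> s _ _ w /=; do 4!case: (holds _ _). Qed.

Lemma sound_modal5 : sound (ax_modal5 L).
Proof. by move=> s _ _ w /=; rewrite !step_same; do 2!case: (holds _ _). Qed.

Lemma sound_vacGen : sound (ax_vacGen L).
Proof.
move=> s [_ inv] _ w.
have {}inv : invariant (on_vr s 0) (on_fm s 0).
  by apply: inv; apply: DV_mk_scheme => //; right; right; [left | right].
by rewrite /= !inv andbb implybb.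
Qed.

Lemma sound_spec_DV : sound (ax_spec_DV L).
Proof.
move=> s [_ inv] _ w.
have {}inv : invariant (on_vr s 0) (on_fm s 0).
  by apply: inv; apply: DV_mk_scheme => //; right; left; [left | right].
by rewrite /= !inv andbb implybb.
Qed.

Lemma sound_ALLcomm : sound (ax_ALLcomm L).
Proof.
move=> s _ _ w /=; have [->|/eqP xy] := eqVneq (on_vr s 0) (on_vr s 1).
  by rewrite implybb.
by rewrite !(stepC _ _ _ _ _ xy) andbACA implybb.
Qed.

Lemma sound_EQrefl : sound (ax_EQrefl L).
Proof. by move=> s _ _ w /=. Qed.

Lemma sound_EQsymm : sound (ax_EQsymm L).
Proof. by move=> s _ _ w; rewrite /= eq_sym implybb. Qed.

Lemma sound_EQtrans : sound (ax_EQtrans L).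
Proof. by move=> s _ _ w /=; do 3!case: (w.1 _). Qed.

Lemma sound_denot : sound (ax_denot L).
Proof.
move=> s [dis _] _ w.
have xy : on_vr s 0 <> on_vr s 1.
  apply: dis; apply: DV_mk_scheme => //; right; first by left; left.
  by right; left.
(* Whatever the value of [x], one of the two values of [y] matches it. *)
by rewrite /= !step_at !step_off //; case: (w.1 _).
Qed.

Lemma sound_subst : sound (ax_subst L).
Proof.
move=> s [dis _] _ w.
have xy : on_vr s 1 <> on_vr s 0.
  apply/nesym/dis; apply: DV_mk_scheme => //; first by left.
    by right; left.
  by right; right; left; right.
(* Both quantifiers reach the same two states, and the equation holds only in the one where [x]
   takes the value of [y]. *)
rewrite /= !step_same !step_at !step_off //.
by case: (w.1 _); do 2!case: (holds _ _).
Qed.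

Lemma sound_ALLeq : sound (ax_ALLeq L).
Proof.
move=> s _ _ w /=; have [->|/eqP xy] := eqVneq (on_vr s 0) (on_vr s 1).
  by rewrite implybb implybT.
(* For distinct variables the antecedent is false: one of the two values of [x] differs from that of
   [y]. *)
by rewrite !step_at !step_off; [case: (w.1 _)|exact: nesym..].
Qed.

Lemma sound_genEq : sound (ax_genEq L).
Proof.
move=> s _ _ w /=.
have [->|/eqP/nesym xy] := eqVneq (on_vr s 0) (on_vr s 1).
  by rewrite !eqxx.
have [->|/eqP/nesym xz] := eqVneq (on_vr s 0) (on_vr s 2).
  by rewrite !eqxx implybT.
by rewrite !step_at !(step_off _ _ _ _ xy) !(step_off _ _ _ _ xz);
  do 2!case: (w.1 _).
Qed.

Lemma sound_axioms Psi :
  ((TMM L `\ ax_spec L) `|` [set ax_spec_DV L]) Psi -> sound Psi.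
Proof.
case=> [[T nspec]|->]; last exact: sound_spec_DV.
move: T; rewrite /TMM.
(* The union is left-nested, so its members are peeled off from the last one. *)
repeat (case; last by move=> e; first
  [ by case: nspec
  | rewrite e; first
    [ exact: sound_minimp | exact: sound_peirce | exact: sound_contrap
    | exact: sound_notelim | exact: sound_gen | exact: sound_ALLdistr
    | exact: sound_modal5 | exact: sound_vacGen | exact: sound_ALLcomm
    | exact: sound_EQrefl | exact: sound_EQsymm | exact: sound_EQtrans
    | exact: sound_denot | exact: sound_subst | exact: sound_ALLeq
    | exact: sound_genEq ]]).
by move=> ->; exact: sound_mp.
Qed.

End Semantics.

(** With the bit false [phi] fails, yet both updates at variable 0 raise the bit. *)
Lemma spec_invalid (L : language) : ~ valid L (concl (ax_spec L)).
Proof. by move=> /(_ (fun=> true, false)); rewrite /= !step_bit. Qed.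

Theorem proposition3p11 (L : language) :
  ~ provable ((TMM L `\ ax_spec L) `|` [set ax_spec_DV L]) (ax_spec L) /\
  independent (TMM L) (ax_spec L).
Proof.
split; last split.
- by case=> P /(soundness _ _ _ (sound_axioms L)); exact: spec_invalid.
(* Ten members of [TMM] follow [spec]. *)
- by do 10!left; right.
- case=> P /soundness; move/(_ _)/spec_invalid; apply=> Psi SPsi.
  by apply: sound_axioms; left.
Qed.
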